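(* Let $M$ be a positive integer, $\Omega^{(\mathrm I)}=\{(k_1,k_2)\in(\mathbf Z_{\ge0})^2:\ 2k_1+k_2\le M-2\}$ and $\Omega^{(\mathrm{III})}=\{(k_1,k_2)\in\mathbf Z_{\ge 0}\times\mathbf Z_{\ge1}:\ 2k_1+k_2\le M-2\}$. Write $\ddot H(\heartsuit)=\overset{N=4}{\ddot H}(\Lambda^{(M)(1,0)(\heartsuit)}_{k_1,k_2})$ with $(k_1,k_2)\in\Omega^{(\heartsuit)}$, $\heartsuit\in\{\mathrm I,\mathrm{III}\}$, and $E_{ab}(\tau,z)=\dfrac{\vartheta_{ab}(\tau,z)^2}{\eta(\tau)^3\vartheta_{11}(\tau,2z)}$. Then: 1) (I) $\mathrm{ch}^{(+)}_{\ddot H(\mathrm I)}(\tau,z)=i\,\Psi^{[M,1,0;\frac12]}_{k_1+\frac12,\,k_1+k_2+\frac12;\,\frac12}(\tau,z,-z,0)\,E_{00}(\tau,z)$; (III) $\mathrm{ch}^{(+)}_{\ddot H(\mathrm{III})}(\tau,z)=i\,\Psi^{[M,1,0;\frac12]}_{k_1+k_2+\frac12,\,k_1+\frac12;\,\frac12}(\tau,z,-z,0)\,E_{00}(\tau,z)$. 2) (I) $\mathrm{ch}^{(-)}_{\ddot H(\mathrm I)}(\tau,z)=i\,\Psi^{[M,1,0;0]}_{k_1+\frac12,\,k_1+k_2+\frac12;\,\frac12}(\tau,z,-z,0)\,E_{01}(\tau,z)$; (III) $\mathrm{ch}^{(-)}_{\ddot H(\mathrm{III})}(\tau,z)=i\,\Psi^{[M,1,0;0]}_{k_1+k_2+\frac12,\,k_1+\frac12;\,\frac12}(\tau,z,-z,0)\,E_{01}(\tau,z)$.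 $1)^{\mathrm{tw}}$ (I) $\mathrm{ch}^{(+)\mathrm{tw}}_{\ddot H(\mathrm I)}(\tau,z)=i\,\Psi^{[M,1,0;\frac12]}_{k_1+k_2,\,k_1+1;\,0}(\tau,z,-z,0)\,E_{10}(\tau,z)$; (III) $\mathrm{ch}^{(+)\mathrm{tw}}_{\ddot H(\mathrm{III})}(\tau,z)=i\,\Psi^{[M,1,0;\frac12]}_{k_1,\,k_1+k_2+1;\,0}(\tau,z,-z,0)\,E_{10}(\tau,z)$. $2)^{\mathrm{tw}}$ (I) $\mathrm{ch}^{(-)\mathrm{tw}}_{\ddot H(\mathrm I)}(\tau,z)=i\,\Psi^{[M,1,0;0]}_{k_1+k_2,\,k_1+1;\,0}(\tau,z,-z,0)\,E_{11}(\tau,z)$; (III) $\mathrm{ch}^{(-)\mathrm{tw}}_{\ddot H(\mathrm{III})}(\tau,z)=i\,\Psi^{[M,1,0;0]}_{k_1,\,k_1+k_2+1;\,0}(\tau,z,-z,0)\,E_{11}(\tau,z)$.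
   Context: Functions. $q=e^{2\pi i\tau}$. For $m\in\frac12\mathbf Z_{>0}$, $s\in\frac12\mathbf Z$: $\Phi^{[m,s]}_1(\tau,z_1,z_2,t)=e^{-2\pi imt}\sum_{j\in\mathbf Z}\frac{e^{2\pi imj(z_1+z_2)+2\pi isz_1}q^{mj^2+sj}}{1-e^{2\pi iz_1}q^j}$, $\Phi^{[m,s]}_2(\tau,z_1,z_2,t)=e^{-2\pi imt}\sum_{j\in\mathbf Z}\frac{e^{-2\pi imj(z_1+z_2)-2\pi isz_2}q^{mj^2+sj}}{1-e^{-2\pi iz_2}q^j}$, $\Phi^{[m,s]}=\Phi^{[m,s]}_1-\Phi^{[m,s]}_2$. For $\varepsilon,\varepsilon'\in\{0,\frac12\}$ and $j,k\in\varepsilon'+\mathbf Z$: $\Psi^{[M,m,s;\varepsilon]}_{j,k;\varepsilon'}(\tau,z_1,z_2,t)=q^{\frac mMjk}e^{\frac{2\pi im}{M}(kz_1+jz_2)}\Phi^{[m,s]}(M\tau,z_1+j\tau+\varepsilon,z_2+k\tau-\varepsilon,\frac tM)$. $\vartheta_{ab}(\tau,z)=\sum_{n\in\mathbf Z}e^{\pi i(n+\frac a2)^2\tau+2\pi i(n+\frac a2)(z+\frac b2)}$ (Mumford), $\eta(\tau)=q^{1/24}\prod_{n\ge1}(1-q^n)$. Affine superalgebra. $\widehat A(1,1)$ is the affine Lie superalgebra of $sl(2|2)/\mathbf CI$ with simple roots $\alpha_0,\alpha_2$ (even), $\alpha_1,\alpha_3$ (odd), and $(\alpha_0|\alpha_0)=2$,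 $(\alpha_2|\alpha_2)=-2$, $(\alpha_1|\alpha_1)=(\alpha_3|\alpha_3)=(\alpha_1|\alpha_3)=(\alpha_0|\alpha_2)=0$, $(\alpha_0|\alpha_1)=(\alpha_0|\alpha_3)=-1$, $(\alpha_1|\alpha_2)=(\alpha_2|\alpha_3)=1$ (so $\alpha_1,\alpha_3$ coincide as functions on the Cartan subalgebra). $\delta=\sum_{i=0}^3\alpha_i$, $\theta=\alpha_1+\alpha_2+\alpha_3$, $(\Lambda_0|\alpha_j)=\delta_{j,0}$, $(\Lambda_0|\Lambda_0)=0$, $\rho=-\frac12(\alpha_1+\alpha_3)$, dual Coxeter number $0$. The Cartan subalgebra is identified with its dual via $(\cdot|\cdot)$, with coordinates $(\tau,z_1,z_2,t)=2\pi i(-\tau\Lambda_0+z+t\delta)$, $z=-\frac{z_1-z_2}2(\alpha_1+\alpha_3)-z_1\alpha_2$; thus $e^{-\alpha_1}=e^{-\alpha_3}=e^{2\pi iz_1}$, $e^{-\alpha_2}=e^{-2\pi i(z_1+z_2)}$, $e^{\Lambda_0}=e^{2\pi it}$, $e^{-\delta}=q$. Put $t_\alpha(\lambda)=\lambda+(\lambda|\delta)\alpha-\{\frac{(\alpha|\alpha)}2(\lambda|\delta)+(\lambda|\alpha)\}\delta$, $r_\theta(\lambda)=\lambda-(\lambda|\theta)\theta$, $r_{\alpha_2}(\lambda)=\lambda+(\lambda|\alpha_2)\alpha_2$, and $w.\lambda=w(\lambda+\rho)-\rho$. Characters of modules. All characters are normalized (super)characters ($+$: character, $-$: supercharacter),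 $\widehat R^{(\pm)}$ is the (super)denominator, and ''numerator'' means the product $\widehat R^{(\pm)}\mathrm{ch}^{(\pm)}$. They are given by the following formulas. For $0\le m_2\le m$ let $\Lambda^{(m,m_2)}=m\Lambda_0+\frac{m_2}2(\alpha_1+\alpha_3)$ and $F^{(\pm)}=\sum_{j\in\mathbf Z}t_{j\theta}\Big(\frac{e^{\Lambda^{(m,m_2)}+\rho}}{(1\pm e^{-\alpha_1})(1\pm e^{-\alpha_3})}\Big)$; then $\widehat R^{(\pm)}\mathrm{ch}^{(\pm)}_{L(\Lambda^{(m,m_2)})}=F^{(\pm)}-r_\theta F^{(\pm)}$. For $\beta=\beta[b_1,b_2]:=-\frac{b_1-b_2}2(\alpha_1+\alpha_3)-b_1\alpha_2$ and a type $\heartsuit$ put: (I) $\overline y=1$, $\beta=\beta[k_1,-(k_1+k_2)]$; (III) $\overline y=r_{\alpha_2}$, $\beta=\beta[k_1+k_2,-k_1]$. The principal admissible weight is $\Lambda^{(M)(m,m_2)(\heartsuit)}_{k_1,k_2}=(t_\beta\overline y).(\Lambda^{(m,m_2)}-(M-1)\frac mM\Lambda_0)$ and its irreducible highest weight module has $[\widehat R^{(\pm)}\mathrm{ch}^{(\pm)}_{L(\Lambda^{(M)(m,m_2)(\heartsuit)}_{k_1,k_2})}](\tau,z,t)=[\widehat R^{(\pm)}\mathrm{ch}^{(\pm)}_{L(\Lambda^{(m,m_2)})}]\big(M\tau,\overline y^{-1}(z+\tau\beta),\frac1M(t+(z|\beta)+\frac{\tau|\beta|^2}2)\big)$. Twisted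 functions are $f^{\mathrm{tw}}(h)=f(w_0h)$ with $w_0=r_{\alpha_2}t_{-\frac12\alpha_2}$, i.e. $w_0(\tau,z_1,z_2,t)=(\tau,-z_2+\frac\tau2,-z_1+\frac\tau2,t+\frac{z_1+z_2}2-\frac\tau4)$. For $0\le m_2\le m-1$, $\ddot L(\Lambda^{(M)(m,m_2)(\heartsuit)}_{k_1,k_2})=L(\Lambda^{(M)(m,m_2)(\heartsuit)}_{k_1,k_2})\oplus L(\Lambda^{(M)(m,m_2+1)(\heartsuit)}_{k_1,k_2})$, with $\mathrm{ch}^{(\pm)}_{\ddot L}=\mathrm{ch}^{(\pm)}_{L(\Lambda^{(M)(m,m_2)(\heartsuit)}_{k_1,k_2})}\pm\mathrm{ch}^{(\pm)}_{L(\Lambda^{(M)(m,m_2+1)(\heartsuit)}_{k_1,k_2})}$ and the same for twisted characters. N=4 characters. $\overset{N=4}{\ddot H}(\Lambda)$ is the quantum Hamiltonian reduction of $\ddot L(\Lambda)$ for $(x=\frac12\theta,f=e_{-\theta})$, a module of the N=4 superconformal algebra of central charge $-6(\frac mM+1)$. Its characters are given by $[\overset{N=4}R{}^{(\pm)}\mathrm{ch}^{(\pm)}_{\ddot H}](\tau,z)=[\widehat R^{(\pm)}\mathrm{ch}^{(\pm)}_{\ddot L}](\tau,z+\frac\tau2,z-\frac\tau2,\frac\tau4)$, and likewise with ''tw'' throughout, where the N=4 denominators are $\overset{N=4}R{}^{(+)}=-i\frac{\eta(\tau)^3\vartheta_{11}(\tau,2z)}{\vartheta_{00}(\tau,z)^2}$,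 $\overset{N=4}R{}^{(-)}=i\frac{\eta(\tau)^3\vartheta_{11}(\tau,2z)}{\vartheta_{01}(\tau,z)^2}$, $\overset{N=4}R{}^{(+)\mathrm{tw}}=-i\frac{\eta(\tau)^3\vartheta_{11}(\tau,2z)}{\vartheta_{10}(\tau,z)^2}$, $\overset{N=4}R{}^{(-)\mathrm{tw}}=i\frac{\eta(\tau)^3\vartheta_{11}(\tau,2z)}{\vartheta_{11}(\tau,z)^2}$. *)

(* Defs.v *)
From Stdlib Require Import Reals ZArith Lra Lia.
From Coquelicot Require Import Coquelicot.

Open Scope C_scope.

Definition ZtoC (n : Z) : C := RtoC (IZR n).

Definition Cexp (z : C) : C :=
  (exp (Re z) * cos (Im z), exp (Re z) * sin (Im z))%R.

(** [e2pi x] is e^(2 pi i x), and [qpow tau x] is q^x = e^(2 pi i tau x). *)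
Definition e2pi (x : C) : C := Cexp (RtoC (2 * PI) * Ci * x).
Definition qpow (tau x : C) : C := e2pi (tau * x).

(** Limits and sums are taken componentwise; like [Lim_seq] and [Series] they
    are total, and only meaningful for convergent arguments. *)
Definition CLim (u : nat -> C) : C :=
  (real (Lim_seq (fun n => Re (u n))), real (Lim_seq (fun n => Im (u n)))).
Definition CSeries (u : nat -> C) : C :=
  (Series (fun n => Re (u n)), Series (fun n => Im (u n))).

(** Sum over all integers j: the terms j >= 0 plus the terms j = -1-n < 0. *)
Definition ZSeries (f : Z -> C) : C :=
  CSeries (fun n => f (Z.of_nat n)) + CSeries (fun n => f (- 1 - Z.of_nat n)%Z).

Fixpoint Cprod (f : nat -> C) (n : nat) : C :=
  match n with O => 1 | S p => Cprod f p * f (S p) end.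

Definition theta (a b : Z) (tau z : C) : C :=
  ZSeries (fun n =>
    Cexp (RtoC PI * Ci * (ZtoC n + ZtoC a / 2) * (ZtoC n + ZtoC a / 2) * tau
          + 2 * RtoC PI * Ci * (ZtoC n + ZtoC a / 2) * (z + ZtoC b / 2))).

Definition eta (tau : C) : C :=
  qpow tau (1 / 24) * CLim (Cprod (fun n => 1 - qpow tau (RtoC (INR n)))).

Definition Phi1 (m s : R) (tau z1 z2 t : C) : C :=
  e2pi (- (m * t)) *
  ZSeries (fun j =>
    e2pi (m * ZtoC j * (z1 + z2) + s * z1)
      * qpow tau (m * ZtoC j * ZtoC j + s * ZtoC j)
    / (1 - e2pi z1 * qpow tau (ZtoC j))).

Definition Phi2 (m s : R) (tau z1 z2 t : C) : C :=
  e2pi (- (m * t)) *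
  ZSeries (fun j =>
    e2pi (- (m * ZtoC j * (z1 + z2)) - s * z2)
      * qpow tau (m * ZtoC j * ZtoC j + s * ZtoC j)
    / (1 - e2pi (- z2) * qpow tau (ZtoC j))).

Definition Phi (m s : R) (tau z1 z2 t : C) : C :=
  Phi1 m s tau z1 z2 t - Phi2 m s tau z1 z2 t.

(** The function of level [M, m, s] with shift [eps] and indices [j], [k].
    The label [eps'] records the class of [j] and [k] modulo 1 and does not
    enter the formula. *)
Definition Psi (M : Z) (m s eps eps' j k : R) (tau z1 z2 t : C) : C :=
  qpow tau (m / ZtoC M * j * k)
  * e2pi (m / ZtoC M * (k * z1 + j * z2))
  * Phi m s (ZtoC M * tau) (z1 + j * tau + eps) (z2 + k * tau - eps)
      (t / ZtoC M).

Definition E (a b : Z) (tau z : C) : C :=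
  theta a b tau z ^ 2 / (eta tau ^ 3 * theta 1 1 tau (2 * z)).

(** Coordinates in the basis Lambda_0, alpha_1, alpha_2, delta. The roots
    alpha_1 and alpha_3 are equal as weights. *)
Record weight := Weight { cL0 : C; ca1 : C; ca2 : C; cdelta : C }.

Definition wadd (x y : weight) : weight :=
  Weight (cL0 x + cL0 y) (ca1 x + ca1 y) (ca2 x + ca2 y) (cdelta x + cdelta y).
Definition wscal (c : C) (x : weight) : weight :=
  Weight (c * cL0 x) (c * ca1 x) (c * ca2 x) (c * cdelta x).

Declare Scope weight_scope.
Delimit Scope weight_scope with W.
Bind Scope weight_scope with weight.
Infix "+" := wadd : weight_scope.
Notation "c *: x" := (wscal c%C x) (at level 40) : weight_scope.
Notation "- x" := (wscal (- (1))%C x) : weight_scope.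
Notation "x - y" := (wadd x (wscal (- (1))%C y)) : weight_scope.

(** The Gram matrix of the form in this basis; see [form_simple_roots]. *)
Definition form (x y : weight) : C :=
  cL0 x * cdelta y + cdelta x * cL0 y
  + ca1 x * ca2 y + ca2 x * ca1 y - 2 * ca2 x * ca2 y.

Definition Lambda0 := Weight 1 0 0 0.
Definition delta := Weight 0 0 0 1.
Definition alpha1 := Weight 0 1 0 0.
Definition alpha2 := Weight 0 0 1 0.
Definition alpha3 := alpha1.
Definition alpha0 : weight := (delta - alpha1 - alpha2 - alpha3)%W.
Definition theta_root : weight := (alpha1 + alpha2 + alpha3)%W.
Definition rho : weight := ((- (1 / 2)) *: (alpha1 + alpha3))%W.

Definition transl (alpha lambda : weight) : weight :=
  (lambda + form lambda delta *: alpha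
   - (form alpha alpha / 2 * form lambda delta + form lambda alpha) *: delta)%W.
Definition r_theta (lambda : weight) : weight :=
  (lambda - form lambda theta_root *: theta_root)%W.
Definition r_alpha2 (lambda : weight) : weight :=
  (lambda + form lambda alpha2 *: alpha2)%W.

(** The element beta[b1, b2]; the finite part z of a point of the Cartan
    subalgebra is [beta_vec z1 z2] as well. *)
Definition beta_vec (b1 b2 : C) : weight :=
  ((- ((b1 - b2) / 2)) *: (alpha1 + alpha3) - b1 *: alpha2)%W.

(** The point (tau, z, t) of the Cartan subalgebra, identified with its dual. *)
Definition point (tau : C) (z : weight) (t : C) : weight :=
  (RtoC (2 * PI) * Ci) *: ((- tau) *: Lambda0 + z + t *: delta).

Definition exp_weight (lambda h : weight) : C := Cexp (form lambda h).

Inductive charsign := chplus | chminus.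
Definition sg (s : charsign) : C := match s with chplus => 1 | chminus => - (1) end.

Definition Lambda_mm2 (m m2 : Z) : weight :=
  (ZtoC m *: Lambda0 + (ZtoC m2 / 2) *: (alpha1 + alpha3))%W.

Definition F_base (s : charsign) (m m2 : Z) (h : weight) : C :=
  exp_weight (Lambda_mm2 m m2 + rho) h
  / ((1 + sg s * exp_weight (- alpha1) h) * (1 + sg s * exp_weight (- alpha3) h)).

(** A Weyl group element w acts on functions by (w f)(h) = f(w^-1 h), so that
    w(e^lambda) = e^(w lambda); see [exp_weight_transl], [exp_weight_r_theta].
    The inverse of t_alpha is t_(-alpha) and r_theta is an involution. *)
Definition F (s : charsign) (m m2 : Z) (h : weight) : C :=
  ZSeries (fun j => F_base s m m2 (transl (- (ZtoC j *: theta_root)) h)).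

Definition num_L (s : charsign) (m m2 : Z) (tau : C) (z : weight) (t : C) : C :=
  F s m m2 (point tau z t) - F s m m2 (r_theta (point tau z t)).

Inductive heart := typeI | typeIII.

Definition ybar (h : heart) (lambda : weight) : weight :=
  match h with typeI => lambda | typeIII => r_alpha2 lambda end.
(** [ybar h] is an involution; see [ybarK]. *)
Definition ybar_inv (h : heart) : weight -> weight := ybar h.

Definition beta_of (h : heart) (k1 k2 : Z) : weight :=
  match h with
  | typeI => beta_vec (ZtoC k1) (- (ZtoC k1 + ZtoC k2))
  | typeIII => beta_vec (ZtoC k1 + ZtoC k2) (- ZtoC k1)
  end.

(** The principal admissible weight (t_beta ybar).(Lambda - (M-1) m/M Lambda_0),
    the highest weight of the module whose numerator is [num_adm]; see
    [adm_weight_leading]. *)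
Definition adm_weight (M m m2 : Z) (h : heart) (k1 k2 : Z) : weight :=
  (transl (beta_of h k1 k2)
     (ybar h (Lambda_mm2 m m2
              - ((ZtoC M - 1) * (ZtoC m / ZtoC M)) *: Lambda0 + rho)) - rho)%W.

(** The function f evaluated at (M tau, ybar^-1(z + tau beta),
    (t + (z|beta) + tau |beta|^2 / 2) / M). *)
Definition adm_subst (M : Z) (h : heart) (k1 k2 : Z) (f : C -> weight -> C -> C)
    (tau : C) (z : weight) (t : C) : C :=
  let beta := beta_of h k1 k2 in
  f (ZtoC M * tau) (ybar_inv h (z + tau *: beta)%W)
    ((1 / ZtoC M) * (t + form z beta + tau * form beta beta / 2)).

Definition num_adm (s : charsign) (M m m2 : Z) (h : heart) (k1 k2 : Z) :
    C -> weight -> C -> C :=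
  adm_subst M h k1 k2 (num_L s m m2).

(** In coordinates (tau, z1, z2, t); [tw] selects the twisted function
    f^tw(h) = f(w_0 h), w_0 = r_alpha2 t_(-alpha2/2); see [w0_point]. *)
Definition coord (tw : bool) (f : C -> weight -> C -> C) (tau z1 z2 t : C) : C :=
  if tw then
    f tau (beta_vec (- z2 + tau / 2) (- z1 + tau / 2))
      (t + (z1 + z2) / 2 - tau / 4)
  else f tau (beta_vec z1 z2) t.

(** Numerator of L(m2) + L(m2+1), with the sign of the second summand given by
    [s]. *)
Definition num_Ldd (s : charsign) (tw : bool) (M m m2 : Z) (h : heart) (k1 k2 : Z)
    (tau z1 z2 t : C) : C :=
  coord tw (num_adm s M m m2 h k1 k2) tau z1 z2 t
  + sg s * coord tw (num_adm s M m (m2 + 1) h k1 k2) tau z1 z2 t.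

Definition R_N4 (s : charsign) (tw : bool) (tau z : C) : C :=
  let num := eta tau ^ 3 * theta 1 1 tau (2 * z) in
  match s, tw with
  | chplus, false => - Ci * (num / theta 0 0 tau z ^ 2)
  | chminus, false => Ci * (num / theta 0 1 tau z ^ 2)
  | chplus, true => - Ci * (num / theta 1 0 tau z ^ 2)
  | chminus, true => Ci * (num / theta 1 1 tau z ^ 2)
  end.

(** Character ([chplus]) or supercharacter ([chminus]), twisted if [tw], of the
    quantum Hamiltonian reduction of L(m2) + L(m2+1). *)
Definition ch_N4 (s : charsign) (tw : bool) (M m m2 : Z) (h : heart) (k1 k2 : Z)
    (tau z : C) : C :=
  num_Ldd s tw M m m2 h k1 k2 tau (z + tau / 2) (z - tau / 2) (tau / 4)
  / R_N4 s tw tau z.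

Definition Omega (h : heart) (M k1 k2 : Z) : Prop :=
  match h with
  | typeI => (0 <= k1 /\ 0 <= k2 /\ 2 * k1 + k2 <= M - 2)%Z
  | typeIII => (0 <= k1 /\ 1 <= k2 /\ 2 * k1 + k2 <= M - 2)%Z
  end.

(** 2z is not in Z + Z tau, i.e. theta_11(tau, 2z) <> 0. The factors
    1 -+ e^(2 pi i z) q^r, r in Z/2, in the characters and the Psi then do not
    vanish either, and neither do the theta_ab(tau, z). *)
Definition regular (tau z : C) : Prop :=
  forall a b : Z, 2 * z <> ZtoC a + ZtoC b * tau.

Lemma weight_eq (x y : weight) :
  cL0 x = cL0 y -> ca1 x = ca1 y -> ca2 x = ca2 y -> cdelta x = cdelta y -> x = y.
Proof. destruct x, y; simpl; intros; subst; reflexivity. Qed.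

Lemma form_simple_roots :
  form alpha0 alpha0 = 2 /\ form alpha2 alpha2 = - (2) /\
  form alpha1 alpha1 = 0 /\ form alpha3 alpha3 = 0 /\ form alpha1 alpha3 = 0 /\
  form alpha0 alpha2 = 0 /\ form alpha0 alpha1 = - (1) /\
  form alpha0 alpha3 = - (1) /\ form alpha1 alpha2 = 1 /\
  form alpha2 alpha3 = 1 /\
  form Lambda0 alpha0 = 1 /\ form Lambda0 alpha1 = 0 /\
  form Lambda0 alpha2 = 0 /\ form Lambda0 alpha3 = 0 /\ form Lambda0 Lambda0 = 0.
Proof. unfold form; simpl; repeat split; ring. Qed.

Lemma exp_weight_transl (alpha lambda h : weight) :
  exp_weight lambda (transl (- alpha) h) = exp_weight (transl alpha lambda) h.
Proof. unfold exp_weight; f_equal; unfold transl, form; simpl; field. Qed.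

Lemma exp_weight_r_theta (lambda h : weight) :
  exp_weight lambda (r_theta h) = exp_weight (r_theta lambda) h.
Proof. unfold exp_weight; f_equal; unfold r_theta, form; simpl; ring. Qed.

Lemma exp_weight_point (tau z1 z2 t : C) :
  let h := point tau (beta_vec z1 z2) t in
  exp_weight (- alpha1) h = e2pi z1 /\
  exp_weight (- alpha2) h = e2pi (- (z1 + z2)) /\
  exp_weight Lambda0 h = e2pi t /\
  exp_weight (- delta) h = qpow tau 1.
Proof.
unfold qpow, exp_weight, e2pi; simpl; repeat split; f_equal;
  unfold form; simpl; field.
Qed.

Lemma ybarK (h : heart) (lambda : weight) : ybar h (ybar_inv h lambda) = lambda.
Proof.
destruct h; [reflexivity|].
apply weight_eq; unfold ybar_inv, ybar, r_alpha2, form; simpl; ring.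
Qed.

Lemma w0_point (tau z1 z2 t : C) :
  r_alpha2 (transl ((- (1 / 2)) *: alpha2) (point tau (beta_vec z1 z2) t)) =
  point tau (beta_vec (- z2 + tau / 2) (- z1 + tau / 2))
    (t + (z1 + z2) / 2 - tau / 4).
Proof.
assert (H4 : RtoC 4 = 2 * 2) by (rewrite <- RtoC_mult; f_equal; ring).
apply weight_eq; unfold r_alpha2, transl, form; simpl; rewrite ?H4; field.
Qed.

Lemma adm_weight_leading (M m m2 : Z) (h : heart) (k1 k2 : Z) (tau z1 z2 t : C) :
  M <> 0%Z ->
  adm_subst M h k1 k2
    (fun tau' z' t' => exp_weight (Lambda_mm2 m m2 + rho) (point tau' z' t'))
    tau (beta_vec z1 z2) t
  = exp_weight (adm_weight M m m2 h k1 k2 + rho) (point tau (beta_vec z1 z2) t).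
Proof.
intros HM.
assert (HMC : ZtoC M <> 0).
{ intros H; apply HM, eq_IZR, RtoC_inj; exact H. }
unfold adm_subst, exp_weight; f_equal.
destruct h; unfold adm_weight, ybar_inv, ybar, r_alpha2, transl, form; simpl;
  field; exact HMC.
Qed.

(* Main.v *)
Require Import Defs.
From Stdlib Require Import Reals ZArith Lra Lia.
From Coquelicot Require Import Coquelicot.
Open Scope C_scope.

(** Everything reduces to the Appell sum

      A(a, b) = sum_j e^(2 pi i j (a + b)) q^(j^2) / (1 + s e^(2 pi i a) q^j),

    where s = 1 for characters and s = -1 for supercharacters, and to the
    difference D(a, b) = A(a, b) - A(-b, -a).

    At level 1 the leading terms of L(Lambda^(1,0)) and L(Lambda^(1,1)) are
    e^(2 pi i t) x / (1 + s x)^2 and e^(2 pi i t) / (1 + s x)^2 with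
    x = e^(2 pi i z1). The double pole cancels in the combination that defines
    the direct sum, because x + s = s (1 + s x); what remains is a simple pole.
    Summing over the translations t_(j theta) gives A(z1, -z2), and r_theta
    exchanges z1 and z2, so the numerator is s e^(2 pi i t) D(z1, -z2)
    ([num_L_appell_diff]). The function Psi is an exponential factor times D at
    M tau by its definition ([Psi_appell]): a shift of z1 by 1/2 turns the
    denominator 1 - x into 1 + x, and the two opposite shifts cancel in z1 + z2.

    It remains to follow the substitutions. For untwisted type I, and
    for twisted type III, the arguments of D are those of Psi, in the same order. For
    untwisted type III, and for twisted type I, they come in the opposite order, since
    both r_alpha2 and w_0 send (z1, z2) to (-z2, -z1) up to a translation; there
    one uses D(b, a) = D(a, b) ([appell_diff_swap]). This symmetry comes from
    1 / (1 + u) + 1 / (1 + 1 / u) = 1, by which A(a, b) + A(-a, -b) is a theta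
    series that depends on a + b only. The identity needs u <> -1, which is
    where the regularity of z enters.

    All rearrangements of the sums are justified by absolute convergence: the
    factor q^(j^2) decays faster than any geometric sequence, and the
    denominators stay away from 0 for large j. The denominators of the
    characters then only turn the factor s into the constant i. As the inverse
    of 0 is 0 here, inversion is multiplicative and involutive without
    restriction, and that last step is a formal identity. *)

(** * The exponential function *)

Lemma Cexp_plus (x y : C) : Cexp (x + y) = Cexp x * Cexp y.
Proof.
destruct x as [a b], y as [c d]; unfold Cexp, Cmult; simpl.
rewrite exp_plus, cos_plus, sin_plus; f_equal; ring.
Qed.

Lemma Cexp_0 : Cexp 0 = 1.
Proof.
unfold Cexp; simpl; rewrite exp_0, cos_0, sin_0; unfold RtoC.
f_equal; ring.
Qed.

Lemma e2pi_plus (x y : C) : e2pi (x + y) = e2pi x * e2pi y.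
Proof. unfold e2pi; rewrite <- Cexp_plus; f_equal; ring. Qed.

Lemma e2pi_0 : e2pi 0 = 1.
Proof. unfold e2pi; rewrite <- Cexp_0; f_equal; ring. Qed.

Lemma e2pi_opp_r (x : C) : e2pi x * e2pi (- x) = 1.
Proof. rewrite <- e2pi_plus, <- e2pi_0; f_equal; ring. Qed.

Lemma e2pi_neq_0 (x : C) : e2pi x <> 0.
Proof.
intros H; apply C1_nz; rewrite <- (e2pi_opp_r x), H; ring.
Qed.

Lemma e2pi_coords (x : C) :
  e2pi x = (exp (- (2 * PI * Im x)) * cos (2 * PI * Re x),
            exp (- (2 * PI * Im x)) * sin (2 * PI * Re x))%R.
Proof.
unfold e2pi, Cexp; destruct x as [a b]; simpl.
f_equal; f_equal; f_equal; ring.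
Qed.

Lemma Cmod_e2pi (x : C) : Cmod (e2pi x) = exp (- (2 * PI * Im x)).
Proof.
rewrite e2pi_coords.
set (e := exp _); set (w := (2 * PI * Re x)%R).
unfold Cmod; simpl.
replace (_ + _)%R with (Rsqr e * ((Rsqr (sin w) + Rsqr (cos w))))%R
  by (unfold Rsqr; ring).
rewrite sin2_cos2, Rmult_1_r; apply sqrt_Rsqr; left; apply exp_pos.
Qed.

Lemma e2pi_half (x : C) : e2pi (x + RtoC (1 / 2)) = - e2pi x.
Proof.
rewrite e2pi_plus.
replace (e2pi (RtoC (1 / 2))) with (- (1)); [ring|].
rewrite e2pi_coords; simpl.
replace (2 * PI * (1 / 2))%R with PI by field.
rewrite Rmult_0_r, Ropp_0, exp_0, cos_PI, sin_PI.
unfold RtoC, Copp; simpl; f_equal; ring.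
Qed.

Lemma sg_sqr (s : charsign) : sg s * sg s = 1.
Proof. destruct s; simpl; ring. Qed.

Lemma Cmod_sg (s : charsign) : Cmod (sg s) = 1%R.
Proof. destruct s; simpl; [apply Cmod_1|apply Cmod_m1]. Qed.

(** A zero of 1 + s e^(2 pi i x) forces e^(2 pi i x) = 1 or -1. Doubling x makes
    one statement serve both signs, and is what [regular] is phrased in. *)
Lemma e2pi_sg_pole (s : charsign) (x : C) :
  1 + sg s * e2pi x = 0 -> exists n : Z, 2 * x = ZtoC n.
Proof.
intros H.
assert (He : e2pi x = - sg s).
{ transitivity (sg s * (1 + sg s * e2pi x) - sg s + (1 - sg s * sg s) * e2pi x);
    [ring|].
  rewrite H, sg_sqr; ring. }
assert (Him : Im x = 0%R).
{ assert (Hm : exp (- (2 * PI * Im x)) = exp 0).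
  { rewrite <- Cmod_e2pi, He, Cmod_opp, Cmod_sg, exp_0; reflexivity. }
  apply exp_inv in Hm; pose proof PI_RGT_0; nra. }
assert (Hs : sin (2 * PI * Re x) = 0%R).
{ rewrite e2pi_coords in He; apply (f_equal Im) in He; simpl in He.
  assert (Hz : Im (- sg s) = 0%R) by (destruct s; simpl; ring).
  simpl in Hz; rewrite Hz in He.
  pose proof (exp_pos (- (2 * PI * Im x))).
  apply Rmult_integral in He; destruct He; lra. }
apply sin_eq_0_0 in Hs; destruct Hs as [n Hn].
exists n; destruct x as [a b]; simpl in *; subst b.
unfold ZtoC, RtoC, Cmult; simpl; f_equal; [|ring].
pose proof PI_RGT_0; apply (Rmult_eq_reg_l PI); lra.
Qed.

(** * Inversion extended by 0 *)

Lemma Cinv_0 : / RtoC 0 = 0.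
Proof. unfold Cinv, RtoC; simpl; f_equal; unfold Rdiv; ring. Qed.

Lemma Cinv_mult (x y : C) : / (x * y) = / x * / y.
Proof.
destruct (Ceq_dec x 0) as [->|hx]; [rewrite Cmult_0_l, Cinv_0; ring|].
destruct (Ceq_dec y 0) as [->|hy]; [rewrite Cmult_0_r, Cinv_0; ring|].
field; split; easy.
Qed.

Lemma Cinv_inv (x : C) : / / x = x.
Proof.
destruct (Ceq_dec x 0) as [->|hx]; [rewrite !Cinv_0; easy|].
field; easy.
Qed.

(** * Absolutely convergent sums over the integers *)

(** The two halves overlap at 0, so that reflection just exchanges them. *)
Definition Zabs_summable (f : Z -> C) : Prop :=
  ex_series (fun n => Cmod (f (Z.of_nat n))) /\
  ex_series (fun n => Cmod (f (- Z.of_nat n)%Z)).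

Definition Csummable (u : nat -> C) : Prop :=
  ex_series (fun n => Re (u n)) /\ ex_series (fun n => Im (u n)).

Lemma Csummable_Cmod (u : nat -> C) :
  ex_series (fun n => Cmod (u n)) -> Csummable u.
Proof.
intros H; split.
- apply (ex_series_le (V := R_CompleteNormedModule)) with (2 := H).
  intros n; apply re_le_Cmod.
- apply (ex_series_le (V := R_CompleteNormedModule)) with (2 := H).
  intros n; apply Rle_trans with (2 := Rmax_Cmod _); apply Rmax_r.
Qed.

Lemma CSeries_ext (u v : nat -> C) :
  (forall n, u n = v n) -> CSeries u = CSeries v.
Proof.
intros H; unfold CSeries; f_equal; apply Series_ext; intros n; rewrite H; easy.
Qed.

Lemma CSeries_plus (u v : nat -> C) :
  Csummable u -> Csummable v ->
  CSeries (fun n => u n + v n) = CSeries u + CSeries v.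
Proof.
intros [H1 H2] [H3 H4]; unfold CSeries, Cplus; simpl; f_equal;
  rewrite <- Series_plus by assumption; apply Series_ext; intros n; reflexivity.
Qed.

Lemma CSeries_scal (c : C) (u : nat -> C) :
  Csummable u -> CSeries (fun n => c * u n) = c * CSeries u.
Proof.
intros [H1 H2]; unfold CSeries, Cmult; simpl; f_equal;
  rewrite <- !Series_scal_l.
- rewrite <- Series_minus by (apply (ex_series_scal_l (V := R_NormedModule)); easy).
  apply Series_ext; intros n; reflexivity.
- rewrite <- Series_plus by (apply (ex_series_scal_l (V := R_NormedModule)); easy).
  apply Series_ext; intros n; reflexivity.
Qed.

Lemma CSeries_incr_1 (u : nat -> C) :
  Csummable u -> CSeries u = u 0%nat + CSeries (fun n => u (S n)).
Proof.
intros [H1 H2]; unfold CSeries, Cplus; simpl; f_equal; apply Series_incr_1; easy.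
Qed.

Lemma Zabs_summable_pos (f : Z -> C) :
  Zabs_summable f -> Csummable (fun n => f (Z.of_nat n)).
Proof. intros [H _]; apply Csummable_Cmod, H. Qed.

Lemma Zabs_summable_opp (f : Z -> C) :
  Zabs_summable f -> Zabs_summable (fun j => f (- j)%Z).
Proof.
intros [H1 H2]; split; [exact H2|].
apply ex_series_ext with (2 := H1); intros n; rewrite Z.opp_involutive; easy.
Qed.

Lemma Zabs_summable_neg (f : Z -> C) :
  Zabs_summable f -> Csummable (fun n => f (- 1 - Z.of_nat n)%Z).
Proof.
intros [_ H]; apply Csummable_Cmod.
apply (proj1 (ex_series_incr_1 _)) in H.
apply ex_series_ext with (2 := H); intros n; do 2 f_equal; lia.
Qed.

Lemma ZSeries_ext (f g : Z -> C) :
  (forall j, f j = g j) -> ZSeries f = ZSeries g.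
Proof.
intros H; unfold ZSeries; f_equal; apply CSeries_ext; intros n; apply H.
Qed.

Lemma Zabs_summable_ext (f g : Z -> C) :
  (forall j, f j = g j) -> Zabs_summable f -> Zabs_summable g.
Proof.
intros H [H1 H2]; split;
  [apply ex_series_ext with (2 := H1)|apply ex_series_ext with (2 := H2)];
  intros n; rewrite H; easy.
Qed.

Lemma Zabs_summable_scal (c : C) (f : Z -> C) :
  Zabs_summable f -> Zabs_summable (fun j => c * f j).
Proof.
intros [H1 H2]; split; (eapply ex_series_ext;
  [intros n; symmetry; apply Cmod_mult|]);
  apply (ex_series_scal_l (V := R_NormedModule)); easy.
Qed.

Lemma ZSeries_plus (f g : Z -> C) :
  Zabs_summable f -> Zabs_summable g ->
  ZSeries (fun j => f j + g j) = ZSeries f + ZSeries g.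
Proof.
intros Hf Hg; unfold ZSeries.
rewrite (CSeries_plus (fun n => f (Z.of_nat n))) by (apply Zabs_summable_pos; easy).
rewrite (CSeries_plus (fun n => f (- 1 - Z.of_nat n)%Z))
  by (apply Zabs_summable_neg; easy).
ring.
Qed.

Lemma ZSeries_scal (c : C) (f : Z -> C) :
  Zabs_summable f -> ZSeries (fun j => c * f j) = c * ZSeries f.
Proof.
intros Hf; unfold ZSeries.
rewrite (CSeries_scal c (fun n => f (Z.of_nat n))) by (apply Zabs_summable_pos; easy).
rewrite (CSeries_scal c (fun n => f (- 1 - Z.of_nat n)%Z))
  by (apply Zabs_summable_neg; easy).
ring.
Qed.

(** Reversing the order moves the term at 0 from one half of the sum to the
    other. *)
Lemma ZSeries_opp (f : Z -> C) :
  Zabs_summable f -> ZSeries (fun j => f (- j)%Z) = ZSeries f.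
Proof.
intros Hf; unfold ZSeries.
rewrite (CSeries_incr_1 (fun n => f (- Z.of_nat n)%Z))
  by (apply (Zabs_summable_pos (fun j => f (- j)%Z)), Zabs_summable_opp, Hf).
rewrite (CSeries_incr_1 (fun n => f (Z.of_nat n))) by (apply Zabs_summable_pos, Hf).
rewrite (CSeries_ext (fun n => f (- Z.of_nat (S n))%Z)
  (fun n => f (- 1 - Z.of_nat n)%Z)) by (intros n; f_equal; lia).
rewrite (CSeries_ext (fun n => f (- (- 1 - Z.of_nat n))%Z)
  (fun n => f (Z.of_nat (S n)))) by (intros n; f_equal; lia).
simpl; ring.
Qed.

(** * Convergence of sums with a Gaussian factor *)

(** Only the values far from 0 count: a denominator may vanish at some j. *)
Definition Zbounded (g : Z -> C) : Prop :=
  exists (K : R) (N : nat), forall j : Z,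
    (N <= Z.abs_nat j)%nat -> (Cmod (g j) <= K)%R.

Lemma Zbounded_mult (f g : Z -> C) :
  Zbounded f -> Zbounded g -> Zbounded (fun j => f j * g j).
Proof.
intros [K [N H]] [K' [N' H']]; exists (K * K')%R, (max N N'); intros j Hj.
rewrite Cmod_mult; apply Rmult_le_compat; try apply Cmod_ge_0;
  [apply H|apply H']; lia.
Qed.

Lemma ex_series_eventually_geom (u : nat -> R) (K r : R) (N : nat) :
  (0 <= r < 1)%R -> (forall n, 0 <= u n)%R ->
  (forall n, (N <= n)%nat -> (u n <= K * r ^ n)%R) -> ex_series u.
Proof.
intros Hr Hu H; apply (ex_series_incr_n _ N).
apply (ex_series_le (V := R_CompleteNormedModule)) with
  (b := fun n => (K * r ^ (N + n))%R).
- intros n; unfold norm; simpl; unfold abs; simpl.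
  rewrite Rabs_pos_eq by apply Hu; apply H; lia.
- apply (ex_series_incr_n (fun n => (K * r ^ n)%R) N).
  apply (ex_series_scal_l (V := R_NormedModule)), ex_series_geom.
  rewrite Rabs_pos_eq; lra.
Qed.

Lemma abs_nat_INR (j : Z) : INR (Z.abs_nat j) = Rabs (IZR j).
Proof. rewrite INR_IZR_INZ, Zabs2Nat.id_abs, abs_IZR; reflexivity. Qed.

Lemma exists_nat_above (x : R) : exists N : nat, (x <= INR N)%R.
Proof.
destruct (INR_unbounded x) as [N HN]; exists N; left; exact HN.
Qed.

Lemma exp_opp_nat (n : nat) : exp (- INR n) = (exp (- (1)) ^ n)%R.
Proof.
induction n as [|n IH]; [simpl; rewrite Ropp_0; apply exp_0|].
rewrite S_INR; replace (- (INR n + 1))%R with (- (1) + - INR n)%R by ring.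
rewrite exp_plus, IH; reflexivity.
Qed.

Lemma exp_m1_lt_1 : (0 <= exp (- (1)) < 1)%R.
Proof.
split; [left; apply exp_pos|].
apply Rlt_le_trans with (exp 0); [apply exp_increasing; lra|rewrite exp_0; lra].
Qed.

Lemma Im_scal_pos (M : Z) (tau : C) :
  (0 < M)%Z -> (0 < Im tau)%R -> (0 < Im (ZtoC M * tau))%R.
Proof.
intros hM htau; unfold ZtoC; rewrite im_scal_l.
apply Rmult_lt_0_compat; [apply IZR_lt, hM|exact htau].
Qed.

(** For large j the quadratic term j^2 Im tau dominates j Im d with a margin of
    at least the absolute value of j. *)
Lemma gaussian_decay (c d tau : C) (htau : (0 < Im tau)%R) :
  exists N : nat, forall j : Z, (N <= Z.abs_nat j)%nat ->
  (Cmod (e2pi (c + ZtoC j * d + ZtoC j * ZtoC j * tau))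
   <= exp (- (2 * PI * Im c)) * exp (- (1)) ^ Z.abs_nat j)%R.
Proof.
destruct (exists_nat_above ((1 + Rabs (Im d)) / Im tau)) as [N HN].
exists N; intros j Hj; apply le_INR in Hj.
rewrite Cmod_e2pi, <- exp_opp_nat, <- exp_plus.
rewrite abs_nat_INR in *.
assert (Hl : (1 + Rabs (Im d) <= Rabs (IZR j) * Im tau)%R).
{ apply Rmult_le_reg_r with (/ Im tau)%R; [apply Rinv_0_lt_compat; easy|].
  rewrite Rmult_assoc, Rinv_r by lra; unfold Rdiv in HN; lra. }
replace (Im (c + ZtoC j * d + ZtoC j * ZtoC j * tau)) with
  (Im c + IZR j * Im d + IZR j * IZR j * Im tau)%R
  by (destruct c, d, tau; unfold ZtoC; simpl; ring).
set (x := IZR j) in *.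
assert (Hq : (Rabs x <= x * Im d + x * x * Im tau)%R).
{ assert (Hd : (- (Rabs x * Rabs (Im d)) <= x * Im d)%R).
  { rewrite <- Rabs_mult; pose proof (Rle_abs (- (x * Im d))) as Ha.
    rewrite Rabs_Ropp in Ha; lra. }
  assert (Hx : (x * x = Rabs x * Rabs x)%R).
  { rewrite <- Rabs_mult, Rabs_pos_eq; [easy|apply Rle_0_sqr]. }
  rewrite Hx; pose proof (Rabs_pos x); nra. }
assert (Hp : (1 <= 2 * PI)%R) by (pose proof PI2_1; lra).
assert (Hle : (- (2 * PI * (Im c + x * Im d + x * x * Im tau))
   <= - (2 * PI * Im c) + - Rabs x)%R) by (pose proof (Rabs_pos x); nra).
destruct Hle as [Hlt|He]; [left; apply exp_increasing, Hlt|right; rewrite He; easy].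
Qed.

Lemma Zabs_summable_gaussian (c d tau : C) (g : Z -> C) :
  (0 < Im tau)%R -> Zbounded g ->
  Zabs_summable (fun j => e2pi (c + ZtoC j * d + ZtoC j * ZtoC j * tau) * g j).
Proof.
intros htau [K [N HK]].
destruct (gaussian_decay c d tau htau) as [N' HN'].
set (f := fun j => e2pi (c + ZtoC j * d + ZtoC j * ZtoC j * tau) * g j).
assert (H : forall j, (max N N' <= Z.abs_nat j)%nat ->
  (Cmod (f j) <= exp (- (2 * PI * Im c)) * K * exp (- (1)) ^ Z.abs_nat j)%R).
{ intros j Hj; unfold f; rewrite Cmod_mult.
  replace (_ * K * _)%R with
    (exp (- (2 * PI * Im c)) * exp (- (1)) ^ Z.abs_nat j * K)%R by ring.
  apply Rmult_le_compat; try apply Cmod_ge_0; [apply HN'|apply HK]; lia. }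
split; apply ex_series_eventually_geom with
  (exp (- (2 * PI * Im c)) * K)%R (exp (- (1))) (max N N');
  try apply exp_m1_lt_1; try (intros; apply Cmod_ge_0); intros n Hn.
- replace n with (Z.abs_nat (Z.of_nat n)) at 2 by lia; apply H; lia.
- replace n with (Z.abs_nat (- Z.of_nat n)) at 2 by lia; apply H; lia.
Qed.

(** The modulus of e^(2 pi i (a + j b)) tends to 0 at one end and to infinity at
    the other, so it eventually avoids the interval from 1/2 to 2, and the
    denominator is at distance at least 1/2 from 0. *)
Lemma Zbounded_pole (s : charsign) (a b : C) :
  Im b <> 0%R -> Zbounded (fun j => / (1 + sg s * e2pi (a + ZtoC j * b))).
Proof.
intros Hb; pose proof (Rabs_pos_lt _ Hb) as Hb'.
destruct (exists_nat_above ((1 + Rabs (Im a)) / Rabs (Im b))) as [N HN].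
exists 2%R, N; intros j Hj; apply le_INR in Hj; rewrite abs_nat_INR in Hj.
assert (Hl : (1 + Rabs (Im a) <= Rabs (IZR j) * Rabs (Im b))%R).
{ apply Rmult_le_reg_r with (/ Rabs (Im b))%R; [apply Rinv_0_lt_compat; easy|].
  rewrite Rmult_assoc, Rinv_r by lra; unfold Rdiv in HN; lra. }
set (w := sg s * e2pi (a + ZtoC j * b)).
assert (Hw : Cmod w = exp (- (2 * PI * (Im a + IZR j * Im b)))).
{ unfold w; rewrite Cmod_mult, Cmod_sg, Rmult_1_l, Cmod_e2pi; do 3 f_equal.
  destruct a, b; unfold ZtoC; simpl; ring. }
assert (Hp : (1 <= 2 * PI)%R) by (pose proof PI2_1; lra).
rewrite <- Rabs_mult in Hl.
assert (Hdist : (1 / 2 <= Cmod (1 + w))%R).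
{ assert (T1 : (Cmod w <= Cmod (1 + w) + 1)%R).
  { replace w with ((1 + w) + - (1)) at 1 by ring.
    apply Rle_trans with (1 := Cmod_triangle _ _); rewrite Cmod_m1; lra. }
  assert (T2 : (1 <= Cmod (1 + w) + Cmod w)%R).
  { pose proof (Cmod_triangle (1 + w) (- w)) as T.
    replace (1 + w + - w) with (RtoC 1) in T by ring.
    rewrite Cmod_1, Cmod_opp in T; exact T. }
  set (X := (Im a + IZR j * Im b)%R) in *.
  assert (HX : (X <= - (1) \/ 1 <= X)%R).
  { unfold X; revert Hl; unfold Rabs; do 2 destruct Rcase_abs; intros; lra. }
  destruct HX as [HX|HX].
  - pose proof (exp_ineq1_le (- (2 * PI * X))); nra.
  - pose proof (exp_ineq1_le (2 * PI * X)).
    assert (He : (exp (- (2 * PI * X)) * exp (2 * PI * X) = 1)%R)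
      by (rewrite <- exp_plus, <- exp_0; f_equal; ring).
    pose proof (exp_pos (- (2 * PI * X))).
    assert (H1 : (1 <= 2 * PI * X)%R) by nra.
    assert (H2 : (exp (- (2 * PI * X)) <= 1 / 2)%R) by nra.
    lra. }
assert (Hnz : 1 + w <> 0) by (apply Cmod_gt_0; lra).
rewrite Cmod_inv by exact Hnz.
replace 2%R with (/ (1 / 2))%R by field.
apply Rinv_le_contravar; lra.
Qed.

(** * Appell sums *)

Definition appell_term (s : charsign) (tau a b : C) (j : Z) : C :=
  e2pi (ZtoC j * (a + b) + ZtoC j * ZtoC j * tau)
  / (1 + sg s * e2pi (a + ZtoC j * tau)).

Definition appell (s : charsign) (tau a b : C) : C :=
  ZSeries (appell_term s tau a b).

(** For a = z1 and b = -z2 the second sum is the image of the first under the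
    exchange of z1 and z2, which is how r_theta acts. *)
Definition appell_diff (s : charsign) (tau a b : C) : C :=
  appell s tau a b - appell s tau (- b) (- a).

Lemma appell_term_summable (s : charsign) (tau a b : C) :
  (0 < Im tau)%R -> Zabs_summable (appell_term s tau a b).
Proof.
intros htau.
apply Zabs_summable_ext with
  (2 := Zabs_summable_gaussian 0 (a + b) tau _ htau (Zbounded_pole s a tau (Rgt_not_eq _ _ htau))).
intros j; unfold appell_term, Cdiv; f_equal; f_equal; ring.
Qed.

(** After j -> -j in the second sum both terms have the same Gaussian factor,
    and the fractions add up to 1 / (1 + s x) + 1 / (1 + s / x) = 1. *)
Lemma appell_add_opp (s : charsign) (tau a b : C) :
  (0 < Im tau)%R ->
  (forall j : Z, 1 + sg s * e2pi (a + ZtoC j * tau) <> 0) ->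
  appell s tau a b + appell s tau (- a) (- b)
  = ZSeries (fun j => e2pi (ZtoC j * (a + b) + ZtoC j * ZtoC j * tau)).
Proof.
intros htau ha; unfold appell.
rewrite <- (ZSeries_opp (appell_term s tau (- a) (- b)))
  by (apply appell_term_summable, htau).
rewrite <- ZSeries_plus;
  [|apply appell_term_summable, htau
   |apply Zabs_summable_opp, appell_term_summable, htau].
apply ZSeries_ext; intros j; unfold appell_term, ZtoC.
rewrite opp_IZR, RtoC_opp.
replace (- RtoC (IZR j) * (- a + - b) + - RtoC (IZR j) * - RtoC (IZR j) * tau)
  with (RtoC (IZR j) * (a + b) + RtoC (IZR j) * RtoC (IZR j) * tau) by ring.
set (e := e2pi (RtoC (IZR j) * (a + b) + _)).
specialize (ha j); unfold ZtoC in ha.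
set (w := a + RtoC (IZR j) * tau) in *.
replace (- a + - RtoC (IZR j) * tau) with (- w) by (unfold w; ring).
assert (hw : e2pi (- w) = / e2pi w).
{ transitivity (/ e2pi w * (e2pi w * e2pi (- w))).
  - field; apply e2pi_neq_0.
  - rewrite e2pi_opp_r; ring. }
pose proof (e2pi_neq_0 w) as hx; rewrite hw; set (x := e2pi w) in *.
assert (ha' : 1 + sg s * / x <> 0).
{ intros H; apply ha.
  transitivity (sg s * x * (1 + sg s * / x) + (1 - sg s * sg s)); [field; easy|].
  rewrite H, sg_sqr; ring. }
destruct s; simpl in *; field; repeat split; auto.
all: intros H; apply ha.
- rewrite <- H; ring.
- transitivity (- (x + RtoC (-1))); [ring|rewrite H; ring].
- rewrite <- H; ring.
Qed.

(** The theta series in [appell_add_opp] depends on a + b only, hence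
    A(a, b) + A(-a, -b) = A(b, a) + A(-b, -a). *)
Lemma appell_diff_swap (s : charsign) (tau a b : C) :
  (0 < Im tau)%R ->
  (forall j : Z, 1 + sg s * e2pi (a + ZtoC j * tau) <> 0) ->
  (forall j : Z, 1 + sg s * e2pi (b + ZtoC j * tau) <> 0) ->
  appell_diff s tau b a = appell_diff s tau a b.
Proof.
intros htau ha hb.
pose proof (appell_add_opp s tau a b htau ha) as Ha.
pose proof (appell_add_opp s tau b a htau hb) as Hb.
rewrite (Cplus_comm b a), <- Ha in Hb.
unfold appell_diff.
replace (appell s tau b a) with
  (appell s tau b a + appell s tau (- b) (- a) - appell s tau (- b) (- a)) by ring.
rewrite Hb; ring.
Qed.

(** The shift of z1 that turns the denominator 1 - x of Phi into 1 + s x. *)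
Definition shift_of (s : charsign) : R :=
  match s with chplus => (1 / 2)%R | chminus => 0%R end.

Lemma e2pi_shift (s : charsign) (x : C) :
  e2pi (x + shift_of s) = - (sg s * e2pi x).
Proof.
destruct s; simpl; [rewrite e2pi_half; ring|].
rewrite Cplus_0_r; ring.
Qed.

(** With opposite shifts of the two arguments their sum does not change, so the
    shifts act on the denominators only; for Phi2, which involves -z2, the sign
    of the shift is again the one for Phi1. *)
Lemma Psi_appell (s : charsign) (M : Z) (eps' j k : R) (tau z : C) :
  (0 < M)%Z ->
  Psi M 1 0 (shift_of s) eps' j k tau z (- z) 0
  = e2pi (1 / ZtoC M * (tau * (j * k) + z * (k - j)))
    * appell_diff s (ZtoC M * tau) (z + j * tau) (- z + k * tau).
Proof.
intros hM.
assert (HMC : ZtoC M <> 0) by (intros H; apply RtoC_inj, eq_IZR in H; lia).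
unfold Psi, Phi, qpow at 1; rewrite <- e2pi_plus; f_equal.
{ f_equal; field; easy. }
unfold Phi1, Phi2, appell_diff.
replace (- (1 * (0 / ZtoC M))) with (RtoC 0) by (field; easy).
rewrite e2pi_0, !Cmult_1_l; unfold appell; f_equal;
  apply ZSeries_ext; intros n; unfold appell_term, qpow;
  rewrite <- !e2pi_plus; unfold Cdiv; f_equal.
- f_equal; ring.
- f_equal.
  replace (z + j * tau + shift_of s + ZtoC M * tau * ZtoC n) with
    (z + j * tau + ZtoC n * (ZtoC M * tau) + shift_of s) by ring.
  rewrite e2pi_shift; ring.
- f_equal; ring.
- f_equal.
  replace (- (- z + k * tau - shift_of s) + ZtoC M * tau * ZtoC n) with
    (- (- z + k * tau) + ZtoC n * (ZtoC M * tau) + shift_of s) by ring.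
  rewrite e2pi_shift; ring.
Qed.

(** * Numerators of the affine modules *)

Lemma point_transl (tau z1 z2 t : C) (j : C) :
  transl (- (j *: theta_root)) (point tau (beta_vec z1 z2) t)
  = point tau (beta_vec (z1 - j * tau) (z2 + j * tau))
      (t + j * (z2 - z1) + j * j * tau).
Proof.
apply weight_eq; unfold transl, form; simpl; field.
Qed.

Lemma point_r_theta (tau z1 z2 t : C) :
  r_theta (point tau (beta_vec z1 z2) t) = point tau (beta_vec z2 z1) t.
Proof.
apply weight_eq; unfold r_theta, form; simpl; field.
Qed.

Lemma F_base_point (s : charsign) (m2 : Z) (tau z1 z2 t : C) :
  F_base s 1 m2 (point tau (beta_vec z1 z2) t)
  = e2pi (t + (1 - ZtoC m2) * z1)
    * (/ (1 + sg s * e2pi z1) * / (1 + sg s * e2pi z1)).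
Proof.
destruct (exp_weight_point tau z1 z2 t) as [H1 _].
unfold F_base, alpha3; rewrite H1; clear H1.
unfold Cdiv; f_equal.
- unfold exp_weight, e2pi, form; f_equal; simpl; unfold ZtoC; field.
- apply Cinv_mult.
Qed.

(** The numerators e^(2 pi i z1) and 1 of the two modules combine with the
    double pole to a simple one, since x + s = s (1 + s x) for s = 1 or -1. The
    translation by j theta shifts z1 by - j tau, so that j and -j have to be
    exchanged as well. *)
Lemma F_appell (s : charsign) (tau z1 z2 t : C) :
  (0 < Im tau)%R ->
  F s 1 0 (point tau (beta_vec z1 z2) t)
  + sg s * F s 1 1 (point tau (beta_vec z1 z2) t)
  = sg s * e2pi t * appell s tau z1 (- z2).
Proof.
intros htau.
set (term := fun m2 j => F_base s 1 m2
  (transl (- (ZtoC j *: theta_root)) (point tau (beta_vec z1 z2) t))).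
assert (Hterm : forall m2 j, term m2 j =
  e2pi (t + (1 - ZtoC m2) * z1 + ZtoC j * (z2 - z1 - (1 - ZtoC m2) * tau)
        + ZtoC j * ZtoC j * tau)
  * (/ (1 + sg s * e2pi (z1 + ZtoC j * (- tau)))
     * / (1 + sg s * e2pi (z1 + ZtoC j * (- tau))))).
{ intros m2 j; unfold term; rewrite point_transl, F_base_point.
  replace (z1 - ZtoC j * tau) with (z1 + ZtoC j * - tau) by ring.
  f_equal; f_equal; ring. }
assert (Him : Im (- tau) <> 0%R) by (destruct tau; simpl in *; lra).
assert (Hsum : forall m2, Zabs_summable (term m2)).
{ intros m2; apply Zabs_summable_ext with (1 := fun j => eq_sym (Hterm m2 j)).
  apply Zabs_summable_gaussian; [exact htau|].
  apply Zbounded_mult; apply Zbounded_pole, Him. }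
change (ZSeries (term 0%Z) + sg s * ZSeries (term 1%Z)
  = sg s * e2pi t * ZSeries (appell_term s tau z1 (- z2))).
rewrite <- (ZSeries_opp (term 0%Z)), <- (ZSeries_opp (term 1%Z)) by apply Hsum.
rewrite <- (ZSeries_scal (sg s)) by apply Zabs_summable_opp, Hsum.
rewrite <- (ZSeries_scal (sg s * e2pi t)) by apply appell_term_summable, htau.
rewrite <- ZSeries_plus;
  [|apply Zabs_summable_opp, Hsum|apply Zabs_summable_scal, Zabs_summable_opp, Hsum].
apply ZSeries_ext; intros j; rewrite !Hterm; unfold appell_term, Cdiv.
replace (ZtoC (- j)) with (- ZtoC j) by (unfold ZtoC; rewrite opp_IZR, RtoC_opp; easy).
replace (- ZtoC j * - tau) with (ZtoC j * tau) by ring.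
set (u := z1 + ZtoC j * tau).
set (g := ZtoC j * (z1 + - z2) + ZtoC j * ZtoC j * tau).
replace (t + (1 - ZtoC 0) * z1 + - ZtoC j * (z2 - z1 - (1 - ZtoC 0) * tau)
  + - ZtoC j * - ZtoC j * tau) with (t + g + u) by (unfold g, u, ZtoC; ring).
replace (t + (1 - ZtoC 1) * z1 + - ZtoC j * (z2 - z1 - (1 - ZtoC 1) * tau)
  + - ZtoC j * - ZtoC j * tau) with (t + g) by (unfold g, u, ZtoC; ring).
rewrite !e2pi_plus; set (x := e2pi u).
(* At x = -s both sides vanish, as the inverse of 0 is 0. *)
assert (Hx : (x + sg s) * (/ (1 + sg s * x) * / (1 + sg s * x))
  = sg s * / (1 + sg s * x)).
{ replace (x + sg s) with (sg s * (1 + sg s * x) + (1 - sg s * sg s) * x) by ring.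
  rewrite sg_sqr.
  destruct (Ceq_dec (1 + sg s * x) 0) as [->|h]; [rewrite Cinv_0; ring|].
  field; exact h. }
transitivity (e2pi t * e2pi g
  * ((x + sg s) * (/ (1 + sg s * x) * / (1 + sg s * x)))); [ring|].
rewrite Hx; ring.
Qed.

Lemma num_L_appell_diff (s : charsign) (tau z1 z2 t : C) :
  (0 < Im tau)%R ->
  num_L s 1 0 tau (beta_vec z1 z2) t + sg s * num_L s 1 1 tau (beta_vec z1 z2) t
  = sg s * e2pi t * appell_diff s tau z1 (- z2).
Proof.
intros htau; unfold num_L, appell_diff; rewrite point_r_theta.
replace (- - z2) with z2 by ring.
pose proof (F_appell s tau z1 z2 t htau) as H1.
pose proof (F_appell s tau z2 z1 t htau) as H2.
transitivity ((F s 1 0 (point tau (beta_vec z1 z2) t)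
  + sg s * F s 1 1 (point tau (beta_vec z1 z2) t))
  - (F s 1 0 (point tau (beta_vec z2 z1) t)
  + sg s * F s 1 1 (point tau (beta_vec z2 z1) t))); [ring|].
rewrite H1, H2; ring.
Qed.

(** * The reduced characters *)

Lemma adm_subst_typeI (M k1 k2 : Z) (f : C -> weight -> C -> C) (tau z1 z2 t : C) :
  adm_subst M typeI k1 k2 f tau (beta_vec z1 z2) t
  = f (ZtoC M * tau)
      (beta_vec (z1 + ZtoC k1 * tau) (z2 - (ZtoC k1 + ZtoC k2) * tau))
      (1 / ZtoC M * (t + (ZtoC k1 + ZtoC k2) * z1 - ZtoC k1 * z2
                     + ZtoC k1 * (ZtoC k1 + ZtoC k2) * tau)).
Proof.
unfold adm_subst; f_equal.
- apply weight_eq; simpl; field.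
- f_equal; unfold form; simpl; field.
Qed.

Lemma adm_subst_typeIII (M k1 k2 : Z) (f : C -> weight -> C -> C)
    (tau z1 z2 t : C) :
  adm_subst M typeIII k1 k2 f tau (beta_vec z1 z2) t
  = f (ZtoC M * tau)
      (beta_vec (- z2 + ZtoC k1 * tau) (- z1 - (ZtoC k1 + ZtoC k2) * tau))
      (1 / ZtoC M * (t + ZtoC k1 * z1 - (ZtoC k1 + ZtoC k2) * z2
                     + ZtoC k1 * (ZtoC k1 + ZtoC k2) * tau)).
Proof.
unfold adm_subst; f_equal.
- apply weight_eq; unfold ybar_inv, ybar, r_alpha2, form; simpl; field.
- f_equal; unfold form; simpl; field.
Qed.

(** The denominators have the constants -i and i, with inverses i and -i, for
    the two values of s; so the factor s is what brings both to i. *)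
Lemma ch_N4_E (s : charsign) (tw : bool) (M : Z) (h : heart) (k1 k2 : Z)
    (tau z P : C) :
  num_Ldd s tw M 1 0 h k1 k2 tau (z + tau / 2) (z - tau / 2) (tau / 4)
  = sg s * P ->
  ch_N4 s tw M 1 0 h k1 k2 tau z =
  Ci * P * E (if tw then 1 else 0) (match s with chplus => 0 | chminus => 1 end)
    tau z.
Proof.
intros H; unfold ch_N4, R_N4, E; rewrite H.
set (N := eta tau ^ 3 * theta 1 1 tau (2 * z)).
destruct s, tw; simpl; unfold Cdiv; rewrite !Cinv_mult, !Cinv_inv;
  first [rewrite <- Ci_inv, Cinv_inv|rewrite Ci_inv]; ring.
Qed.

(** A pole at a would make twice (a + j M tau) an integer, and so put 2 z into
    Z + Z tau. *)
Lemma regular_no_pole (s : charsign) (M : Z) (tau z a : C) (p : Z) :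
  regular tau z ->
  2 * a = 2 * z + ZtoC p * tau \/ 2 * a = - (2 * z) + ZtoC p * tau ->
  forall j : Z, 1 + sg s * e2pi (a + ZtoC j * (ZtoC M * tau)) <> 0.
Proof.
intros hz ha j H; destruct (e2pi_sg_pole _ _ H) as [n Hn].
destruct ha as [ha|ha].
- apply (hz n (- (p + 2 * j * M))%Z).
  unfold ZtoC in *; rewrite opp_IZR, plus_IZR, !mult_IZR, RtoC_opp, RtoC_plus, !RtoC_mult.
  rewrite <- Hn.
  replace (2 * z) with (2 * a - IZR p * tau) by (rewrite ha; ring).
  ring.
- apply (hz (- n) (p + 2 * j * M))%Z.
  unfold ZtoC in *; rewrite opp_IZR, plus_IZR, !mult_IZR, RtoC_opp, RtoC_plus, !RtoC_mult.
  rewrite <- Hn.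
  replace (2 * z) with (IZR p * tau - 2 * a) by (rewrite ha; ring).
  ring.
Qed.

Lemma num_L_Psi (s : charsign) (M : Z) (eps' j k : R) (tau z z1 z2 t : C) :
  (0 < M)%Z -> (0 < Im tau)%R ->
  z1 = z + j * tau -> z2 = z - k * tau ->
  t = 1 / ZtoC M * (tau * (j * k) + z * (k - j)) ->
  num_L s 1 0 (ZtoC M * tau) (beta_vec z1 z2) t
  + sg s * num_L s 1 1 (ZtoC M * tau) (beta_vec z1 z2) t
  = sg s * Psi M 1 0 (shift_of s) eps' j k tau z (- z) 0.
Proof.
intros hM htau -> -> ->.
rewrite num_L_appell_diff, Psi_appell by (easy || apply Im_scal_pos; easy).
replace (- (z - k * tau)) with (- z + k * tau) by ring.
ring.
Qed.

(** Here the arguments of D are exchanged, so poles have to be excluded. With 2 j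
    and 2 k integers, a pole of either sum at z would put 2 z into Z + Z tau. *)
Lemma num_L_Psi_swap (s : charsign) (M : Z) (eps' j k : R) (p r : Z)
    (tau z z1 z2 t : C) :
  (0 < M)%Z -> (0 < Im tau)%R -> regular tau z ->
  (2 * j = IZR p)%R -> (2 * k = IZR r)%R ->
  z1 = - z + k * tau -> z2 = - z - j * tau ->
  t = 1 / ZtoC M * (tau * (j * k) + z * (k - j)) ->
  num_L s 1 0 (ZtoC M * tau) (beta_vec z1 z2) t
  + sg s * num_L s 1 1 (ZtoC M * tau) (beta_vec z1 z2) t
  = sg s * Psi M 1 0 (shift_of s) eps' j k tau z (- z) 0.
Proof.
intros hM htau hz hj hk -> -> ->.
rewrite num_L_appell_diff, Psi_appell by (easy || apply Im_scal_pos; easy).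
replace (- (- z - j * tau)) with (z + j * tau) by ring.
rewrite appell_diff_swap; [ring|apply Im_scal_pos; easy| |].
- apply (regular_no_pole _ _ _ z _ p hz); left.
  unfold ZtoC; rewrite <- hj, RtoC_mult; ring.
- apply (regular_no_pole _ _ _ z _ r hz); right.
  unfold ZtoC; rewrite <- hk, RtoC_mult; ring.
Qed.

(** Both the element r_alpha2 of type III and the twist w_0 exchange the
    arguments, so [num_L_Psi] applies when none or both of them occur, and
    [num_L_Psi_swap] when exactly one does. *)
Lemma num_Ldd_Psi (s : charsign) (tw : bool) (M : Z) (h : heart) (k1 k2 : Z)
    (tau z : C) :
  (0 < M)%Z -> (0 < Im tau)%R -> regular tau z ->
  let k1' := IZR k1 in
  let k2' := IZR k2 in
  let half := (1 / 2)%R in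
  num_Ldd s tw M 1 0 h k1 k2 tau (z + tau / 2) (z - tau / 2) (tau / 4)
  = sg s * match h, tw with
    | typeI, false =>
        Psi M 1 0 (shift_of s) half (k1' + half) (k1' + k2' + half) tau z (- z) 0
    | typeIII, false =>
        Psi M 1 0 (shift_of s) half (k1' + k2' + half) (k1' + half) tau z (- z) 0
    | typeI, true =>
        Psi M 1 0 (shift_of s) 0 (k1' + k2') (k1' + 1) tau z (- z) 0
    | typeIII, true =>
        Psi M 1 0 (shift_of s) 0 k1' (k1' + k2' + 1) tau z (- z) 0
    end.
Proof.
intros hM htau hz k1' k2' half.
assert (HMC : ZtoC M <> 0) by (intros H; apply RtoC_inj, eq_IZR in H; lia).
assert (Hh : RtoC half = 1 / 2) by (unfold half; apply RtoC_div; lra).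
unfold num_Ldd, num_adm, coord; change (0 + 1)%Z with 1%Z.
destruct h, tw; rewrite ?adm_subst_typeI, ?adm_subst_typeIII.
- apply num_L_Psi_swap with (p := (2 * (k1 + k2))%Z) (r := (2 * (k1 + 1))%Z);
    try easy; unfold k1', k2', ZtoC;
    rewrite ?mult_IZR, ?plus_IZR, ?RtoC_plus; try ring; field; easy.
- apply num_L_Psi; try easy; rewrite ?RtoC_plus, Hh; unfold k1', k2', ZtoC; field; easy.
- apply num_L_Psi; try easy; rewrite ?RtoC_plus; unfold k1', k2', ZtoC; field; easy.
- apply num_L_Psi_swap with (p := (2 * (k1 + k2) + 1)%Z) (r := (2 * k1 + 1)%Z);
    try easy.
  + unfold k1', k2', half; rewrite ?plus_IZR, mult_IZR, plus_IZR; field.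
  + unfold k1', half; rewrite ?plus_IZR, mult_IZR; field.
  + rewrite ?RtoC_plus, Hh; unfold k1', k2', ZtoC; field; easy.
  + rewrite ?RtoC_plus, Hh; unfold k1', k2', ZtoC; field; easy.
  + rewrite ?RtoC_plus, Hh; unfold k1', k2', ZtoC; field; easy.
Qed.

Theorem proposition5p4 (M : Z) (hM : (0 < M)%Z) (k1 k2 : Z) (tau z : C)
    (htau : (0 < Im tau)%R) (hz : regular tau z) :
  let k1' := IZR k1 in
  let k2' := IZR k2 in
  let half := (1 / 2)%R in
  (Omega typeI M k1 k2 ->
   ch_N4 chplus false M 1 0 typeI k1 k2 tau z =
   Ci * Psi M 1 0 half half (k1' + half) (k1' + k2' + half) tau z (- z) 0
   * E 0 0 tau z) /\
  (Omega typeIII M k1 k2 ->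
   ch_N4 chplus false M 1 0 typeIII k1 k2 tau z =
   Ci * Psi M 1 0 half half (k1' + k2' + half) (k1' + half) tau z (- z) 0
   * E 0 0 tau z) /\
  (Omega typeI M k1 k2 ->
   ch_N4 chminus false M 1 0 typeI k1 k2 tau z =
   Ci * Psi M 1 0 0 half (k1' + half) (k1' + k2' + half) tau z (- z) 0
   * E 0 1 tau z) /\
  (Omega typeIII M k1 k2 ->
   ch_N4 chminus false M 1 0 typeIII k1 k2 tau z =
   Ci * Psi M 1 0 0 half (k1' + k2' + half) (k1' + half) tau z (- z) 0
   * E 0 1 tau z) /\
  (Omega typeI M k1 k2 ->
   ch_N4 chplus true M 1 0 typeI k1 k2 tau z =
   Ci * Psi M 1 0 half 0 (k1' + k2') (k1' + 1) tau z (- z) 0 * E 1 0 tau z) /\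
  (Omega typeIII M k1 k2 ->
   ch_N4 chplus true M 1 0 typeIII k1 k2 tau z =
   Ci * Psi M 1 0 half 0 k1' (k1' + k2' + 1) tau z (- z) 0 * E 1 0 tau z) /\
  (Omega typeI M k1 k2 ->
   ch_N4 chminus true M 1 0 typeI k1 k2 tau z =
   Ci * Psi M 1 0 0 0 (k1' + k2') (k1' + 1) tau z (- z) 0 * E 1 1 tau z) /\
  (Omega typeIII M k1 k2 ->
   ch_N4 chminus true M 1 0 typeIII k1 k2 tau z =
   Ci * Psi M 1 0 0 0 k1' (k1' + k2' + 1) tau z (- z) 0 * E 1 1 tau z).
Proof.
intros k1' k2' half.
repeat apply conj; intros _;
  match goal with |- ch_N4 ?s ?tw _ _ _ ?h _ _ _ _ = _ =>
    exact (ch_N4_E s tw M h k1 k2 tau z _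
             (num_Ldd_Psi s tw M h k1 k2 tau z hM htau hz))
  end.
Qed.
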